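(* Let $\mathbb P$ be a partially exchangeable probability distribution on $\Omega=(\mathcal X\times\mathcal Y)^{(k+1)N}$. For any partially exchangeable positive real measurable function $\lambda:\Omega\times\Theta\to\mathbb R_+$ and any partially exchangeable posterior distribution $\pi:\Omega\to\mathcal M_+^1(\Theta)$, $$\mathbb P\Bigl\{\exp\Bigl[\sup_{\rho\in\mathcal M_+^1(\Theta)}\rho\Bigl[\lambda\bigl[\Phi_{\frac\lambda N}(\overline r)-r_1\bigr]\Bigr]-\mathcal K(\rho,\pi)\Bigr]\Bigr\}\le1.$$
   Context: $N,k\ge1$ are integers, $\mathcal X$ a measurable space, $\mathcal Y$ a finite set, $\Omega=(\mathcal X\times\mathcal Y)^{(k+1)N}$ with coordinate process $(X_i,Y_i)_{i=1}^{(k+1)N}$. $(\Theta,\mathcal T)$ is a measurable space and $(\theta,x)\mapsto f_\theta(x)\in\mathcal Y$ is measurable; $\sigma$-algebras are countably generated. For $i=1,\dots,N$, $\tau_i:\Omega\to\Omega$ is defined by $\tau_i(\omega)_{i+jN}=\omega_{i+(j-1)N}$ for $j=1,\dots,k$, $\tau_i(\omega)_i=\omega_{i+kN}$, and $\tau_i(\omega)_{m+jN}=\omega_{m+jN}$ for $m\ne i$, $1\le m\le N$, $0\le j\le k$. $\mathbb P$ is partially exchangeable if $\mathbb P\circ\tau_i^{-1}=\mathbb P$ for all $i=1,\dots,N$; a function $h$ of $\omega$ (and $\theta$) is partially exchangeable if $h(\tau_i(\omega),\cdot)=h(\omega,\cdot)$ for all $i$; a posterior distribution (regular conditional probability measure)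 $\pi:\Omega\to\mathcal M_+^1(\Theta)$ is partially exchangeable if $\pi(\tau_i(\omega),A)=\pi(\omega,A)$ for all $\omega\in\Omega$, $i=1,\dots,N$, $A\in\mathcal T$. $$r_1(\theta)=\frac1N\sum_{i=1}^N\mathbf 1[f_\theta(X_i)\ne Y_i],\qquad\overline r(\theta)=\frac1{(k+1)N}\sum_{i=1}^{(k+1)N}\mathbf 1[f_\theta(X_i)\ne Y_i].$$ $\Phi_a(p)=-a^{-1}\log\{1-p[1-\exp(-a)]\}$. $\mathcal M_+^1(\Theta)$ is the set of probability measures on $\Theta$, $\rho(h)=\int h\,d\rho$, $\mathbb P(Z)$ is the expectation of $Z$, and $\mathcal K(\rho,\pi)=\int\log(d\rho/d\pi)\,d\rho$ if $\rho\ll\pi$, $+\infty$ otherwise. The supremum is over the whole expression $\rho[\cdots]-\mathcal K(\rho,\pi)$, where $\lambda,\overline r,r_1$ are functions of $\theta$ for fixed $\omega$. *)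

(* Defs.v *)
From HB Require Import structures.
From mathcomp Require Import all_boot all_order all_algebra.
From mathcomp Require Import all_classical all_reals all_analysis.
From mathcomp Require Import measurable_realfun.

Set Implicit Arguments.
Unset Strict Implicit.
Unset Printing Implicit Defensive.

Import Order.TTheory GRing.Theory Num.Theory.

Local Open Scope classical_set_scope.
Local Open Scope ring_scope.

Definition countably_generated d (T : measurableType d) : Prop :=
  exists2 G : set (set T), countable G & @measurable d T = <<s G >>.

(* Indices are counted from 0: the pair (X_{i + jN}, Y_{i + jN}), for
   1 <= i <= N and 0 <= j <= k, is component (i - 1) + jN of the sample, a
   (k.+1 * N)-tuple with the product sigma-algebra.  Thus [p %% N] identifies
   the class [i] of the position [p], and the positions [p < N] carry the
   first N observations. *)

Section PartialExchangeability.
Variables (N k : nat).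

Lemma rot_pos_subproof (p : 'I_(k.+1 * N)) :
  ((if p < N then p + k * N else p - N) < k.+1 * N)%N.
Proof.
case: ifP => [pN|_]; first by rewrite [ltnRHS]mulSn ltn_add2r.
exact: leq_ltn_trans (leq_subr _ _) (ltn_ord p).
Qed.

(* The position from which [tau i] reads its component [p]. *)
Definition rot_pos (i : 'I_N) (p : 'I_(k.+1 * N)) : 'I_(k.+1 * N) :=
  if (p %% N == i)%N then Ordinal (rot_pos_subproof p) else p.

Definition tau (T : Type) (i : 'I_N) (w : (k.+1 * N).-tuple T) :
    (k.+1 * N).-tuple T :=
  [tuple tnth w (rot_pos i p) | p < k.+1 * N].

Definition pexch_measure (R : realType) d (T : measurableType d)
    (P : set ((k.+1 * N).-tuple T) -> \bar R) : Prop :=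
  forall (i : 'I_N) (A : set ((k.+1 * N).-tuple T)),
    measurable A -> pushforward P (tau i) A = P A.

Definition pexch_fun (T S V : Type) (h : (k.+1 * N).-tuple T -> S -> V) : Prop :=
  forall (i : 'I_N) (w : (k.+1 * N).-tuple T) (s : S), h (tau i w) s = h w s.

Definition pexch_posterior (R : realType) (T : Type) d (Theta : measurableType d)
    (pi : (k.+1 * N).-tuple T -> set Theta -> \bar R) : Prop :=
  forall (w : (k.+1 * N).-tuple T) (i : 'I_N) (A : set Theta),
    measurable A -> pi (tau i w) A = pi w A.

End PartialExchangeability.

Section ErrorRates.
Variables (R : realType) (X : Type) (Y : eqType) (Theta : Type).
Variables (f : Theta -> X -> Y) (N k : nat).
Implicit Types (w : (k.+1 * N).-tuple (X * Y)) (t : Theta).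

Definition err t (z : X * Y) : R := (f t z.1 != z.2)%:R.

Definition r1 w t : R :=
  N%:R^-1 * \sum_(p < k.+1 * N | (p < N)%N) err t (tnth w p).

Definition rbar w t : R :=
  (k.+1 * N)%:R^-1 * \sum_(p < k.+1 * N) err t (tnth w p).

End ErrorRates.

(* [0^-1 = 0] gives [Phi 0 p = 0]; where [Phi (lambda / N)] occurs it is
   multiplied by [lambda], so the value at 0 is immaterial. *)
Definition Phi (R : realType) (a p : R) : R :=
  - a^-1 * ln (1 - p * (1 - expR (- a))).

Section RelativeEntropy.
Local Open Scope ereal_scope.
Local Open Scope charge_scope.

Definition KL (R : realType) d (T : measurableType d)
    (rho pi : probability T R) : \bar R :=
  if `[< rho `<< pi >] then
    \int[rho]_t lne (('d (charge_of_finite_measure rho) '/d pi) t)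
  else +oo.

(* In [\bar R] one has +oo - +oo = -oo, both in the integral of a function
   whose positive and negative parts have infinite integral and in the
   subtraction of [KL]: an undetermined rho does not contribute to the sup. *)
Definition sup_entropy (R : realType) d (T : measurableType d)
    (h : T -> R) (pi : probability T R) : \bar R :=
  ereal_sup [set \int[rho]_t (h t)%:E - KL rho pi
            | rho in [set: probability T R]].

End RelativeEntropy.

(* Main.v *)
Require Import Defs.
From HB Require Import structures.
From mathcomp Require Import all_boot all_order all_algebra.
From mathcomp Require Import all_classical all_reals all_analysis.
From mathcomp Require Import measurable_realfun zify ring lra.

Set Implicit Arguments.
Unset Strict Implicit.
Unset Printing Implicit Defensive.

Import Order.TTheory GRing.Theory Num.Theory.

Local Open Scope classical_set_scope.
Local Open Scope ring_scope.

(** Two facts carry the proof.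

    The Donsker-Varadhan identity [donsker_varadhan] turns the supremum over
    [rho] into a Laplace transform: [expeR (sup_entropy h pi)] is the integral
    of [expR h] under [pi].  One inequality is Gibbs' [integral_sub_KL_le]: if
    [g] is the density of [rho] and [c] the logarithm of the integral of
    [expR h], then [ln x <= x - 1] applied to [expR (h - c) / g] bounds [h] by
    [ln g + c] plus a function whose [rho]-integral is at most 0.
    The other tests the supremum on the measures of density proportional to
    [expR h] on the set where [`|h| <= n], and lets [n] grow.  The penalty [h] may be unbounded, so the
    identity is needed for arbitrary measurable [h]; it also gives the
    measurability of the random variable, since the posterior is a kernel.

    After this step one has to bound the joint mean, that is the [P]-mean of
    the posterior mean, of the exponential of the penalty.  Put
    [a = lambda / N].  An error indicator takes the values 0 and 1, hence
    [expR (- a * err) = 1 - err * (1 - expR (- a))]: this is the gain of a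
    position, and the exponential of the penalty is the product of the gains
    of the first [N] positions times a weight, namely
    [(1 - rbar * (1 - expR (- a))) ^- N] ([expR_penalty_gain]).  The weight,
    and every gain at a position outside the class of [i], are invariant under
    [tau i], which permutes the class of [i] cyclically.  Exchangeability of
    [P], [lambda] and [pi] therefore allows replacing, one class at a time, the
    gain at the first position of a class by the mean gain of that class
    ([joint_prod_average]).  The arithmetic mean of the [N] class means is
    [1 - rbar * (1 - expR (- a))], and the weight is the inverse of its [N]-th
    power, so that the inequality of arithmetic and geometric means bounds the
    new integrand by 1 ([weight_class_mean_le1]). *)

(** * Densities and relative entropy *)

Section Density.
Local Open Scope ereal_scope.
Context d (T : measurableType d) (R : realType).
Implicit Types (rho pi : probability T R) (g h : T -> R).

(** Both parts of the integral are monotone, and subtraction in the extended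
    reals is monotone even at the infinities.  The lemma thus also applies to a
    function [h] of mean [-oo], which the supremum has to allow for. *)
Lemma ae_le_integral (mu : {measure set T -> \bar R}) (F G : T -> \bar R) :
  measurable_fun setT F -> measurable_fun setT G ->
  {ae mu, forall x, F x <= G x} -> \int[mu]_x F x <= \int[mu]_x G x.
Proof.
move=> mF mG FG; rewrite [leLHS]integralE [leRHS]integralE.
apply: leeB; apply: ae_ge0_le_integral => //.
- exact: measurable_funepos.
- exact: measurable_funepos.
- apply: filterS FG => x FGx _; rewrite !funeposE.
  by rewrite ge_max; rewrite !le_max FGx lexx !orbT.
- exact: measurable_funeneg.
- exact: measurable_funeneg.
- apply: filterS FG => x FGx _; rewrite !funenegE.
  by rewrite ge_max; rewrite !le_max leeN2 FGx lexx !orbT.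
Qed.

Lemma integral_fin_num_integrable (mu : {measure set T -> \bar R})
    (F : T -> \bar R) : measurable_fun setT F ->
  \int[mu]_x F x \is a fin_num -> mu.-integrable setT F.
Proof.
move=> mF; rewrite integralE fin_numB => /andP[fp fn].
apply/integrableP; split => //.
under eq_integral do rewrite -/((abse \o F) _) fune_abse.
rewrite ge0_integralD//.
- by rewrite lte_add_pinfty// ltey_eq ?fp ?fn.
- exact: measurable_funepos.
- exact: measurable_funeneg.
Qed.

(** The Radon-Nikodym derivative of a charge is extended-real valued and
    nonnegative only almost everywhere; a real, everywhere nonnegative version
    can be used under logarithms and quotients without side conditions. *)
Definition is_density pi g rho :=
  [/\ measurable_fun setT g, (forall x, (0 <= g x)%R) &
      forall A, measurable A -> rho A = \int[pi]_(x in A) (g x)%:E].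

Lemma is_density_dominates pi g rho : is_density pi g rho -> rho `<< pi.
Proof.
move=> [mg g0 rhoE]; apply/null_content_dominatesP => A mA piA.
rewrite rhoE//; apply: null_set_integral => //.
by apply: measurable_funTS; exact/measurable_EFinP.
Qed.

Lemma dominates_density pi rho : rho `<< pi -> exists g, is_density pi g rho.
Proof.
move=> numu.
have F0 := Radon_Nikodym_SigmaFinite.f_ge0 numu.
have Ff := Radon_Nikodym_SigmaFinite.f_fin_num numu.
exists (fine \o Radon_Nikodym_SigmaFinite.f rho pi); split.
- apply: measurableT_comp => //.
  exact: measurable_int (Radon_Nikodym_SigmaFinite.f_integrable _).
- by move=> x /=; rewrite fine_ge0.
- move=> A mA; rewrite (Radon_Nikodym_SigmaFinite.f_integral numu)//.
  by apply: eq_integral => x _ /=; rewrite fineK.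
Qed.

Section with_density.
Variables (pi : probability T R) (g : T -> R) (rho : probability T R).
Hypothesis dg : is_density pi g rho.

Let numu : rho `<< pi := is_density_dominates dg.
Let mg : measurable_fun setT g. Proof. by case: dg. Qed.
Let g0 x : (0 <= g x)%R. Proof. by case: dg. Qed.
Let mgE : measurable_fun setT (EFin \o g). Proof. exact/measurable_EFinP. Qed.

Lemma density_integral F : measurable_fun setT F -> (forall x, 0 <= F x) ->
  \int[rho]_x F x = \int[pi]_x (F x * (g x)%:E).
Proof.
move=> mF F0; rewrite -(Radon_Nikodym_SigmaFinite.change_of_variables numu)//.
have mf : measurable_fun setT (Radon_Nikodym_SigmaFinite.f rho pi).
  exact: measurable_int (Radon_Nikodym_SigmaFinite.f_integrable _).
apply: ae_eq_integral => //.
- exact: emeasurable_funM.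
- exact: emeasurable_funM.
- apply: ae_eqe_mul2l; apply: integral_ae_eq => //.
    exact: Radon_Nikodym_SigmaFinite.f_integrable.
  move=> E _ mE; rewrite -Radon_Nikodym_SigmaFinite.f_integral//.
  by case: dg => _ _; exact.
Qed.

Lemma density_gt0 : {ae rho, forall x, (0 < g x)%R}.
Proof.
exists (g @^-1` [set 0%R]); split.
- by rewrite -[X in measurable X]setTI; exact: mg.
- case: dg => _ _ ->; last first.
    by rewrite -[X in measurable X]setTI; exact: mg.
  by apply: integral0_eq => x /= ->.
- by move=> x /= /negP; rewrite -leNgt => gx; apply/eqP; rewrite eq_le gx g0.
Qed.

(** The derivative in [KL] and [g] agree almost everywhere for [pi], hence also
    for [rho], which [pi] dominates. *)
Lemma density_KL : KL rho pi = \int[rho]_x (ln (g x))%:E.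
Proof.
rewrite /KL; case: asboolP => // _.
set f := Radon_Nikodym _ _.
have ff x : f x \is a fin_num by exact: Radon_Nikodym_fin_num.
have mf : measurable_fun setT f.
  exact: measurable_int (Radon_Nikodym_integrable _).
have fg : ae_eq rho setT f (EFin \o g).
  apply: (null_dominates_ae_eq _ numu) => //; apply: integral_ae_eq => //.
    exact: Radon_Nikodym_integrable.
  by move=> E _ mE; rewrite -Radon_Nikodym_integral//; case: dg => _ _; exact.
apply: ae_eq_integral => //.
- rewrite (_ : (fun _ => _) = fun t => if (fine (f t) <= 0)%R then -oo
      else (ln (fine (f t)))%:E).
    apply: measurable_fun_ifT => //.
      apply: measurable_fun_ler => //.
      by apply: measurableT_comp.
    apply/measurable_EFinP; apply: measurableT_comp => //.
    by apply: measurableT_comp.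
  by apply/funext => t; rewrite -[in LHS](fineK (ff t)) /=; case: ifPn.
- by apply/measurable_EFinP; exact: measurableT_comp.
- apply: filterS2 fg density_gt0 => x fgx gx _.
  by rewrite fgx//= leNgt gx.
Qed.

End with_density.
End Density.

(** * The Donsker-Varadhan identity: upper bound *)

Section DonskerVaradhan.
Local Open Scope ereal_scope.
Context d (T : measurableType d) (R : realType).
Implicit Types (rho pi : probability T R) (g h : T -> R).

Lemma ln_le_subr1 (x : R) : (0 < x -> ln x <= x - 1)%R.
Proof.
by move=> x0; have := @le_ln1Dx R (x - 1); rewrite addrCA subrr addr0; apply; lra.
Qed.

(** With [0^-1 = 0], inversion coincides on the nonnegative reals with the
    power of exponent -1, whose measurability is known. *)
Lemma measurable_funV_ge0 g : measurable_fun setT g ->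
  (forall x, 0 <= g x)%R -> measurable_fun setT (fun x => (g x)^-1)%R.
Proof.
move=> mg g0; rewrite (_ : (fun _ => _) = fun x => powR (g x) (-1)).
  exact: (measurableT_comp (f := @powR R ^~ (-1)%R)).
by apply/funext => x; rewrite powR_inv1.
Qed.

(** Integrating [u / g] against a measure of density [g] gives back the
    integral of [u], except that the part of [u] where [g] vanishes is lost. *)
Lemma density_ratio_integral pi g rho (u : T -> R) : is_density pi g rho ->
  measurable_fun setT u -> (forall x, 0 <= u x)%R ->
  \int[rho]_x (u x / g x)%:E <= \int[pi]_x (u x)%:E.
Proof.
move=> dg mu u0; have [mg g0 _] := dg.
have muE : measurable_fun setT (EFin \o u) by exact/measurable_EFinP.
have mv : measurable_fun setT (fun x => u x / g x)%R.
  by apply: measurable_funM => //; exact: measurable_funV_ge0.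
have v0 x : (0 <= u x / g x)%R by rewrite divr_ge0.
rewrite (density_integral dg)//; last exact/measurable_EFinP.
apply: ge0_le_integral => //.
- by move=> x _; rewrite mule_ge0 ?lee_fin ?v0 ?g0.
- by apply: emeasurable_funM; exact/measurable_EFinP.
- move=> x _; rewrite -EFinM lee_fin.
  have [->|gx] := eqVneq (g x) 0%R; first by rewrite mulr0 u0.
  by rewrite divfK.
Qed.

(** Almost surely for [rho], [ln x <= x - 1] at [x = expR (h - c) / g] reads
    [h <= ln g + x + (c - 1)], and the [rho]-mean of [x] is at most 1.  Finiteness
    of the entropy makes the right-hand side integrable, whereas the mean of
    [h] may well be [-oo]. *)
Lemma gibbs pi rho g h (c : R) : is_density pi g rho ->
  measurable_fun setT h -> \int[pi]_x (expR (h x - c))%:E <= 1 ->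
  \int[rho]_x (ln (g x))%:E \is a fin_num ->
  \int[rho]_x (h x)%:E <= \int[rho]_x (ln (g x))%:E + c%:E.
Proof.
move=> dg mh hc KLf; have [mg g0 _] := dg.
have mlg : measurable_fun setT (fun x => (ln (g x))%:E).
  by apply/measurable_EFinP; exact: measurableT_comp.
have ilg := integral_fin_num_integrable mlg KLf.
pose v x := (expR (h x - c) / g x)%R.
have mu : measurable_fun setT (fun x => expR (h x - c))%R.
  by apply: measurableT_comp => //; exact: measurable_funB.
have mv : measurable_fun setT v.
  by apply: measurable_funM => //; exact: measurable_funV_ge0.
have v0 x : (0 <= v x)%R by rewrite divr_ge0// expR_ge0.
have v1 : \int[rho]_x (v x)%:E <= 1.
  apply: le_trans hc; apply: density_ratio_integral => // x; exact: expR_ge0.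
have iv : rho.-integrable setT (EFin \o v).
  apply/integrableP; split; first exact/measurable_EFinP.
  under eq_integral do rewrite /= ger0_norm//.
  by rewrite (le_lt_trans v1)// ltry.
have icst : rho.-integrable setT (cst (c - 1)%:E).
  exact: finite_measure_integrable_cst.
have ivc : rho.-integrable setT (fun x => (v x)%:E + cst (c - 1)%:E x).
  exact: integrableD.
apply: (@le_trans _ _ (\int[rho]_x ((ln (g x))%:E + ((v x)%:E + cst (c - 1)%:E x)))).
  apply: ae_le_integral.
  - exact/measurable_EFinP.
  - by apply: emeasurable_funD => //; exact: measurable_int ivc.
  - apply: filterS (density_gt0 dg) => x gx.
    rewrite -!EFinD lee_fin.
    have vx : (0 < v x)%R by rewrite divr_gt0// expR_gt0.
    have := ln_le_subr1 vx.
    by rewrite {1}/v ln_div ?posrE ?expR_gt0// expRK; lra.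
rewrite integralD// integralD// integral_cst//.
rewrite [X in _ * X]probability_setT mule1.
rewrite leeD2l// EFinB addeCA -[leRHS]adde0 leeD2l//.
by rewrite leeBlDr// add0e.
Qed.

(** Here [ln g >= 1 - 1 / g], and the mean of [1 / g] is at most 1.  This
    excludes the value [-oo] for the entropy, which would make its opposite
    [+oo]. *)
Lemma density_log_integral_ge0 pi g rho : is_density pi g rho ->
  0 <= \int[rho]_x (ln (g x))%:E.
Proof.
move=> dg; have [mg g0 _] := dg.
have mv : measurable_fun setT (fun x => 1 / g x)%R.
  by apply: measurable_funM => //; exact: measurable_funV_ge0.
have v1 : \int[rho]_x (1 / g x)%:E <= 1.
  rewrite (le_trans (density_ratio_integral dg _ _))//.
  by rewrite integral_cst// [X in _ * X]probability_setT mule1.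
have iv : rho.-integrable setT (fun x => (1 / g x)%:E).
  apply/integrableP; split; first exact/measurable_EFinP.
  under eq_integral do rewrite /= ger0_norm ?divr_ge0//.
  by rewrite (le_lt_trans v1)// ltry.
have icst : rho.-integrable setT (cst 1 : T -> \bar R).
  exact: finite_measure_integrable_cst.
apply: (@le_trans _ _ (\int[rho]_x (cst 1 x - (1 / g x)%:E))).
  rewrite integralB// integral_cst// [X in _ * X]probability_setT mule1.
  by rewrite sube_ge0 ?orbT.
apply: ae_le_integral.
- by apply: emeasurable_funB => //; exact: measurable_int iv.
- by apply/measurable_EFinP; exact: measurableT_comp.
- apply: filterS (density_gt0 dg) => x gx.
  rewrite -EFinB lee_fin div1r.
  have gx' : (0 < (g x)^-1)%R by rewrite invr_gt0.
  by have := ln_le_subr1 gx'; rewrite lnV//; lra.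
Qed.

Lemma expR_integral_gt0 pi h : measurable_fun setT h ->
  0 < \int[pi]_x (expR (h x))%:E.
Proof.
move=> mh; rewrite lt_neqAle eq_sym integral_ge0 ?andbT; last first.
  by move=> x _; rewrite lee_fin expR_ge0.
apply/eqP => H.
have me : measurable_fun setT (fun x => (expR (h x))%:E).
  by apply/measurable_EFinP; exact: measurableT_comp.
have : \int[pi]_x `|(expR (h x))%:E| = 0.
  by rewrite -[RHS]H; apply: eq_integral => x _ /=; rewrite ger0_norm ?expR_ge0.
move=> /(ae_eq_integral_abs pi measurableT me)[A [mA A0 sub]].
have : pi setT <= pi A.
  by apply: le_measure; rewrite ?inE// => x _; apply: sub => /= /(_ I)[]/eqP;
    rewrite expR_eq0.
by rewrite A0 probability_setT lee_fin ler10.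
Qed.

(** [gibbs] with [c] the logarithm of the integral of [expR h].  In every
    other case one side of the inequality is infinite in the right direction:
    if the entropy is [+oo], subtracting it gives [-oo] whatever the mean of
    [h] is. *)
Lemma integral_sub_KL_le pi rho h : measurable_fun setT h ->
  \int[rho]_x (h x)%:E - KL rho pi <= lne (\int[pi]_x (expR (h x))%:E).
Proof.
move=> mh.
have M0 := expR_integral_gt0 pi mh.
have [->|Moo] := eqVneq (\int[pi]_x (expR (h x))%:E) +oo; first exact: leey.
have [rp|nrp] := pselect (rho `<< pi); last first.
  by rewrite /KL; case: asboolP => //= _; rewrite addeNy leNye.
have [g dg] := dominates_density rp.
rewrite (density_KL dg).
have KL0 := density_log_integral_ge0 dg.
have [->|KLoo] := eqVneq (\int[rho]_x (ln (g x))%:E) +oo.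
  by rewrite addeNy leNye.
have KLf : \int[rho]_x (ln (g x))%:E \is a fin_num.
  by rewrite ge0_fin_numE// lt_neqAle KLoo leey.
have Mf : \int[pi]_x (expR (h x))%:E \is a fin_num.
  by rewrite gt0_fin_numE// lt_neqAle Moo leey.
have M0' : (0 < fine (\int[pi]_x (expR (h x))%:E))%R.
  by rewrite fine_gt0// M0/= lt_neqAle Moo leey.
rewrite leeBlDl// -[X in lne X]fineK// lne_EFin//.
apply: (gibbs dg) => //.
under eq_integral do rewrite expRD expRN lnK ?posrE// EFinM.
rewrite ge0_integralZr//.
- by rewrite -{1}(fineK Mf) -EFinM divff ?gt_eqF.
- by apply/measurable_EFinP; exact: measurableT_comp.
- by rewrite lee_fin invr_ge0 ltW.
Qed.

End DonskerVaradhan.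

(** * The Donsker-Varadhan identity: lower bound *)

Section density_probability.
Local Open Scope ereal_scope.
Context d (T : measurableType d) (R : realType) (pi : probability T R).
Variable g : T -> R.
Hypotheses (mg : measurable_fun setT g) (g0 : forall x, (0 <= g x)%R).
Hypothesis g1 : \int[pi]_x (g x)%:E = 1.

(** The three hypotheses are arguments so that the measure structures below,
    whose axioms depend on them, can be attached to the function. *)
Definition density_prob & measurable_fun setT g & (forall x, (0 <= g x)%R) &
    \int[pi]_x (g x)%:E = 1 := fun A : set T => \int[pi]_(x in A) (g x)%:E.

Local Notation nu := (density_prob mg g0 g1).

Let nu0 : nu set0 = 0. Proof. exact: integral_set0. Qed.

Let nu_ge0 A : 0 <= nu A.
Proof. by apply: integral_ge0 => x _; rewrite lee_fin. Qed.

Let nu_sigma_additive : semi_sigma_additive nu.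
Proof.
by apply: semi_sigma_additive_nng_induced => //; exact/measurable_EFinP.
Qed.

HB.instance Definition _ := isMeasure.Build _ _ _ nu nu0 nu_ge0 nu_sigma_additive.

HB.instance Definition _ := Measure_isProbability.Build _ _ _ nu g1.

Lemma density_prob_is_density : is_density pi g nu.
Proof. by split. Qed.

End density_probability.

Section DonskerVaradhan_identity.
Local Open Scope ereal_scope.
Context d (T : measurableType d) (R : realType).
Variables (pi : probability T R) (h : T -> R).
Hypothesis mh : measurable_fun setT h.

(** Cutting off on both sides makes [h] bounded under the tilted measure, so
    that its mean and the entropy are finite and no cancellation is lost. *)
Definition trunc_exp (n : nat) (x : T) : R :=
  if (`|h x| <= n%:R)%R then expR (h x) else 0%R.

Lemma trunc_exp_ge0 n x : (0 <= trunc_exp n x)%R.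
Proof. by rewrite /trunc_exp; case: ifP => // _; exact: expR_ge0. Qed.

Lemma measurable_trunc_exp n : measurable_fun setT (trunc_exp n).
Proof.
apply: measurable_fun_ifT => //; last exact: measurableT_comp.
by apply: measurable_fun_ler => //; exact: measurableT_comp.
Qed.

Lemma cvg_integral_trunc_exp :
  \int[pi]_x (trunc_exp n x)%:E @[n --> \oo] -->
  \int[pi]_x (fun x => (expR (h x))%:E) x.
Proof.
rewrite (_ : (fun x => _) = fun x => limn (fun n => (trunc_exp n x)%:E)).
  apply: (@cvg_monotone_convergence _ _ _ pi setT measurableT
    (fun n x => (trunc_exp n x)%:E)) => //.
  - by move=> n; apply/measurable_EFinP; exact: measurable_trunc_exp.
  - by move=> n x _; rewrite lee_fin trunc_exp_ge0.
  - move=> x _ m n mn; rewrite lee_fin /trunc_exp.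
    case: ifP => hm; last by case: ifP => // _; exact: expR_ge0.
    by rewrite ifT// (le_trans hm)// ler_nat.
apply/funext => x; apply/esym/cvg_lim => //; apply: cvg_near_cst.
near=> n; rewrite /trunc_exp ifT//; near: n; exact: nbhs_infty_ger.
Unshelve. all: by end_near. Qed.

(** Let [M] be the integral of the truncated exponential, and [rho] the
    measure whose density is that exponential divided by [M].  Then
    [ln g = h - ln M] almost surely for [rho], so the entropy of [rho] is the
    mean of [h] minus [ln M], and [rho] contributes exactly [ln M] to the
    supremum. *)
Lemma integral_trunc_exp_le_sup n :
  \int[pi]_x (trunc_exp n x)%:E <= expeR (sup_entropy h pi).
Proof.
set M := \int[pi]_x _.
have mt := measurable_trunc_exp n.
have M0 : 0 <= M by apply: integral_ge0 => x _; rewrite lee_fin trunc_exp_ge0.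
have [->|Mn0] := eqVneq M 0; first exact: expeR_ge0.
have Mlt : M < +oo.
  apply: (@le_lt_trans _ _ (\int[pi]_x (cst (expR n%:R)%:E x))).
    apply: ge0_le_integral => //.
    - by move=> x _; rewrite lee_fin trunc_exp_ge0.
    - exact/measurable_EFinP.
    - move=> x _; rewrite lee_fin /trunc_exp; case: ifP => [hn|_].
        by rewrite ler_expR (le_trans (ler_norm _)).
      exact: expR_ge0.
  by rewrite integral_cst// [X in _ * X]probability_setT mule1 ltry.
have Mf : M \is a fin_num by rewrite ge0_fin_numE.
have M0' : (0 < fine M)%R by rewrite fine_gt0// lt_neqAle eq_sym Mn0 M0.
pose g x := ((fine M)^-1 * trunc_exp n x)%R.
have mg : measurable_fun setT g by exact: measurable_funM.
have g0 x : (0 <= g x)%R by rewrite mulr_ge0 ?trunc_exp_ge0// invr_ge0 ltW.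
have g1 : \int[pi]_x (g x)%:E = 1.
  under eq_integral do rewrite EFinM.
  rewrite ge0_integralZl//.
  - by rewrite -/M -{2}(fineK Mf) -EFinM mulVf ?gt_eqF.
  - exact/measurable_EFinP.
  - by move=> x _; rewrite lee_fin trunc_exp_ge0.
  - by rewrite lee_fin invr_ge0 ltW.
pose rho : probability T R := density_prob mg g0 g1.
have dg : is_density pi g rho := density_prob_is_density mg g0 g1.
have aeh : {ae rho, forall x, (`|h x| <= n%:R)%R /\ ln (g x) = (h x - ln (fine M))%R}.
  apply: filterS (density_gt0 dg) => x; rewrite /g /trunc_exp.
  case: ifP => hn; last by rewrite mulr0 ltxx.
  move=> _; split => //.
  by rewrite lnM ?posrE ?expR_gt0 ?invr_gt0// lnV ?posrE// expRK addrC.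
have mhE : measurable_fun setT (EFin \o h) by exact/measurable_EFinP.
have ih : rho.-integrable setT (EFin \o h).
  apply/integrableP; split => //.
  apply: (@le_lt_trans _ _ (\int[rho]_x (cst n%:R%:E x))).
    apply: ae_le_integral => //.
      by apply: measurableT_comp.
    by apply: filterS aeh => x [hn _] /=; rewrite lee_fin.
  by rewrite integral_cst// [X in _ * X]probability_setT mule1 ltry.
have KLE : KL rho pi = \int[rho]_x (h x)%:E - (ln (fine M))%:E.
  rewrite (density_KL dg).
  transitivity (\int[rho]_x ((h x)%:E - cst (ln (fine M))%:E x)).
    apply: ae_eq_integral => //.
    - by apply/measurable_EFinP; exact: measurableT_comp.
    - exact: emeasurable_funB.
    - by apply: filterS aeh => x [_ ->] _.
  rewrite integralB//; last exact: finite_measure_integrable_cst.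
  by rewrite integral_cst// [X in _ * X]probability_setT mule1.
have hf : \int[rho]_x (h x)%:E \is a fin_num by exact: integrable_fin_num.
have -> : M = expeR (ln (fine M))%:E by rewrite /= lnK ?posrE// fineK.
rewrite lee_expeR; apply: ereal_sup_ubound; exists rho => //.
by rewrite KLE fin_num_oppeB// addeA subee// add0e.
Qed.

(** The truncated exponentials increase to [expR h], hence the lower bounds
    [integral_trunc_exp_le_sup] exhaust its integral, be it infinite. *)
Theorem donsker_varadhan :
  expeR (sup_entropy h pi) = \int[pi]_x (expR (h x))%:E.
Proof.
apply/eqP; rewrite eq_le; apply/andP; split; last first.
  have /cvg_lim <- // := cvg_integral_trunc_exp.
  apply: lime_le; first by apply/cvg_ex; eexists; exact: cvg_integral_trunc_exp.
  by apply: nearW => n; exact: integral_trunc_exp_le_sup.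
have M0 := ltW (expR_integral_gt0 pi mh).
rewrite -[leRHS]lneK ?in_itv/= ?M0 ?leey// lee_expeR.
by apply: ge_ereal_sup => _ [rho _ <-]; exact: integral_sub_KL_le.
Qed.

End DonskerVaradhan_identity.

(** * The rotation of one class of positions *)

Section Positions.
Variables N k : nat.
Implicit Types (i : 'I_N) (p q : 'I_(k.+1 * N)).

Definition first_pos i : 'I_(k.+1 * N) := widen_ord (leq_pmull N (ltn0Sn k)) i.

Lemma rot_pos_mod i p : (rot_pos i p = p %[mod N])%N.
Proof.
rewrite /rot_pos; case: ifP => // _ /=; case: ltnP => pN.
  by rewrite addnC modnMDl.
by rewrite -[in RHS](subnK pN) modnDr.
Qed.

Lemma rot_pos_neq i p : (p %% N != i)%N -> rot_pos i p = p.
Proof. by rewrite /rot_pos => /negbTE ->. Qed.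

Lemma rot_pos_inj i : injective (@rot_pos N k i).
Proof.
move=> p q pq.
have pqN : (p = q %[mod N])%N by rewrite -(rot_pos_mod i) pq rot_pos_mod.
move: pq; rewrite /rot_pos pqN; case: ifP => // _ /(congr1 val) /= pq.
have pb := ltn_ord p; rewrite [ltnRHS]mulSn in pb.
have qb := ltn_ord q; rewrite [ltnRHS]mulSn in qb.
by apply: val_inj => /=; move: pq; case: (ltnP p N); case: (ltnP q N) => /=; lia.
Qed.

Lemma first_posK i : (first_pos i %% N = i)%N.
Proof. by rewrite /= modn_small. Qed.

(** The rotation moves each later position of the class [N] steps down, hence
    all of them eventually to the first one. *)
Lemma rot_pos_class_constant i V (v : 'I_(k.+1 * N) -> V) :
  (forall q, v (rot_pos i q) = v q) ->
  forall q, (q %% N == i)%N -> v q = v (first_pos i).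
Proof.
move=> vrot q; have [n] := ubnP (val q); elim: n q => // n IHn q qn qi.
have [qN|Nq] := ltnP q N.
  by congr v; apply: val_inj; move: qi => /=; rewrite modn_small// => /eqP.
have N0 : (0 < N)%N by exact: leq_ltn_trans (ltn_ord i).
rewrite -(vrot q); apply: IHn; last by rewrite rot_pos_mod.
rewrite /rot_pos qi /= ifN -?leqNgt//; move: qn => /=; lia.
Qed.

(** The positions split into [k.+1] successive blocks of length [N], each of
    which meets the class exactly once. *)
Lemma card_class i : #|[pred p : 'I_(k.+1 * N) | (p %% N == i)%N]| = k.+1.
Proof.
rewrite -sum1_card /= (big_mkcond _) /=.
rewrite -(big_mkord xpredT (fun p : nat => if (p %% N == i)%N then 1 else 0)%N).
rewrite big_nat_mul.
rewrite (eq_bigr (fun=> 1%N)) ?sum_nat_const_nat ?subn0 ?muln1// => j _.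
rewrite -{1}[(j * N)%N]add0n big_addn mulSn addnK big_mkord.
rewrite (bigD1 i)//= [(i + _)%N]addnC modnMDl modn_small// eqxx big1// => m mi.
by rewrite addnC modnMDl modn_small// ifN.
Qed.

Lemma tnth_tau T i (w : (k.+1 * N).-tuple T) p :
  tnth (tau i w) p = tnth w (rot_pos i p).
Proof. exact: tnth_mktuple. Qed.

Lemma sum_tau (V : nmodType) T i (w : (k.+1 * N).-tuple T) (v : T -> V) :
  \sum_(p < k.+1 * N) v (tnth (tau i w) p) = \sum_(p < k.+1 * N) v (tnth w p).
Proof.
rewrite [RHS](reindex_inj (@rot_pos_inj i)) /=.
by apply: eq_bigr => p _; rewrite tnth_tau.
Qed.

End Positions.

(** * Averaging over the rotations *)

Section JointExpectation.
Local Open Scope ereal_scope.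
Context (R : realType) dZ (Z : measurableType dZ) dT (Theta : measurableType dT).
Variables (N k : nat).
Local Notation sample := ((k.+1 * N).-tuple Z).
Variables (P : probability sample R) (pi : sample -> pprobability Theta R).
Hypotheses (P_pexch : pexch_measure P) (pi_meas : measurable_fun setT pi).
Hypothesis pi_pexch : pexch_posterior pi.
Implicit Types (G F : sample -> Theta -> R) (i j : 'I_N).

Definition joint_mean G : \bar R := \int[P]_w \int[pi w]_t (G w t)%:E.

Definition jointly_measurable G := measurable_fun [set: sample * Theta] (fun z => G z.1 z.2).

Lemma measurable_posterior_mean G : jointly_measurable G -> (forall w t, (0 <= G w t)%R) ->
  measurable_fun setT (fun w => \int[pi w]_t (G w t)%:E).
Proof.
move=> mG G0.
apply: (measurable_fun_integral_finite_kernel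
  (fun z : sample * Theta => (G z.1 z.2)%:E) (kprobability pi_meas)).
- by move=> z; rewrite lee_fin.
- exact/measurable_EFinP.
Qed.

Lemma posterior_mean_ge0 G w : (forall w t, (0 <= G w t)%R) ->
  0 <= \int[pi w]_t (G w t)%:E.
Proof. by move=> G0; apply: integral_ge0 => t _; rewrite lee_fin. Qed.

Lemma measurable_tau i : measurable_fun setT (@tau N k Z i).
Proof.
apply/measurable_fun_tnthP => p.
rewrite (_ : _ \o _ = fun w : sample => tnth w (rot_pos i p)).
  exact: measurable_tnth.
by apply/funext => w /=; rewrite tnth_tau.
Qed.

Lemma jointly_measurable_section G w : jointly_measurable G -> measurable_fun setT (G w).
Proof. by move=> mG; exact: (measurableT_comp mG (measurable_pair1 w)). Qed.

(** The posterior at [w] and at [tau i w] coincide, hence rotating inside [G]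
    amounts to rotating the posterior mean of [G], whose [P]-mean is invariant
    because [P] is. *)
Lemma joint_tau i G : jointly_measurable G -> (forall w t, (0 <= G w t)%R) ->
  joint_mean (fun w t => G (tau i w) t) = joint_mean G.
Proof.
move=> mG G0; rewrite /joint_mean.
pose H w := \int[pi w]_t (G w t)%:E.
transitivity (\int[P]_w (H \o tau i) w).
  apply: eq_integral => w _ /=; rewrite /H.
  by apply: eq_measure_integral => A mA _; exact/esym/pi_pexch.
transitivity (\int[pushforward P (tau i)]_w H w).
  rewrite ge0_integral_pushforward//.
  - exact: measurable_tau.
  - exact: measurable_posterior_mean.
  - by move=> w _; exact: posterior_mean_ge0.
by apply: eq_measure_integral => [|? A mA _]; [exact: measurable_tau|exact: P_pexch].
Qed.

Lemma joint_sum I (s : seq I) (a : pred I) (G : I -> sample -> Theta -> R) :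
  (forall q, jointly_measurable (G q)) -> (forall q w t, (0 <= G q w t)%R) ->
  joint_mean (fun w t => \sum_(q <- s | a q) G q w t)%R =
  \sum_(q <- s | a q) joint_mean (G q).
Proof.
move=> mG G0; rewrite /joint_mean -big_filter -ge0_integral_sum//.
- apply: eq_integral => w _; rewrite -ge0_integral_sum//.
  + by apply: eq_integral => t _; rewrite -sumEFin big_filter.
  + by move=> q; apply/measurable_EFinP; exact: jointly_measurable_section.
  + by move=> q t _; rewrite lee_fin.
- by move=> q; exact: measurable_posterior_mean.
- by move=> q w _; exact: posterior_mean_ge0.
Qed.

Lemma joint_scale (c : R) G : (0 <= c)%R ->
  jointly_measurable G -> (forall w t, (0 <= G w t)%R) ->
  joint_mean (fun w t => c * G w t)%R = c%:E * joint_mean G.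
Proof.
move=> c0 mG G0; rewrite /joint_mean -ge0_integralZl//.
- apply: eq_integral => w _.
  under eq_integral do rewrite EFinM.
  rewrite ge0_integralZl//.
  + by apply/measurable_EFinP; exact: jointly_measurable_section.
  + by move=> t _; rewrite lee_fin.
- exact: measurable_posterior_mean.
- by move=> w _; exact: posterior_mean_ge0.
Qed.

(** A family of functions indexed by the positions, on which [tau] acts by
    permuting the indices, as it does when the member at [q] depends on the
    sample only through its component [q] and invariant quantities. *)
Section averaging.
Variable u : 'I_(k.+1 * N) -> sample -> Theta -> R.
Hypotheses (u_meas : forall q, jointly_measurable (u q)) (u_ge0 : forall q w t, (0 <= u q w t)%R).
Hypothesis u_tau : forall i q w t, u q (tau i w) t = u (rot_pos i q) w t.

Definition class_mean i w t : R :=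
  (k.+1%:R^-1 * \sum_(q < k.+1 * N | (q %% N)%N == i) u q w t)%R.

Lemma class_mean_ge0 i w t : (0 <= class_mean i w t)%R.
Proof. by rewrite mulr_ge0// ?invr_ge0// sumr_ge0. Qed.

Lemma class_mean_meas i : jointly_measurable (class_mean i).
Proof.
apply: measurable_funM => //; under eq_fun do rewrite -big_filter.
exact: measurable_sum.
Qed.

Lemma class_mean_tau i j w t : class_mean i (tau j w) t = class_mean i w t.
Proof.
rewrite /class_mean; congr (_ * _)%R.
rewrite [RHS](reindex_inj (@rot_pos_inj N k j)) /=.
by apply: eq_big => [q|q _]; rewrite ?rot_pos_mod// u_tau.
Qed.

(** By [joint_tau] the joint mean of [F] times the member at [q] does not
    change when [q] is rotated, hence it is the same for all [k.+1] positions
    of the class, and so equal to the mean of these values. *)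
Lemma joint_average i F : jointly_measurable F -> (forall w t, (0 <= F w t)%R) ->
  (forall w t, F (tau i w) t = F w t) ->
  joint_mean (fun w t => F w t * u (first_pos k i) w t)%R =
  joint_mean (fun w t => F w t * class_mean i w t)%R.
Proof.
move=> mF F0 F_tau.
pose v q := joint_mean (fun w t => F w t * u q w t)%R.
have mFu q : jointly_measurable (fun w t => F w t * u q w t)%R.
  by apply: measurable_funM; [exact: mF|exact: u_meas].
have Fu0 q w t : (0 <= F w t * u q w t)%R by rewrite mulr_ge0.
have v_rot q : v (rot_pos i q) = v q.
  rewrite /v -[RHS](@joint_tau i) //; congr joint_mean.
  by apply/funext => w; apply/funext => t; rewrite F_tau u_tau.
have vE := rot_pos_class_constant v_rot.
transitivity (joint_mean (fun w t => k.+1%:R^-1 *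
    \sum_(q < k.+1 * N | (q %% N)%N == i) (F w t * u q w t))%R); last first.
  congr joint_mean; apply/funext => w; apply/funext => t.
  by rewrite -mulr_sumr mulrCA.
rewrite joint_scale//; last 2 first.
- rewrite /jointly_measurable; under eq_fun do rewrite -big_filter.
  exact: (measurable_sum _ mFu).
- by move=> w t; exact: sumr_ge0.
rewrite joint_sum// (eq_bigr (fun=> v (first_pos k i)))//.
rewrite -/(v _).
have -> : \sum_(q < k.+1 * N | (q %% N)%N == i) v (first_pos k i) =
    k.+1%:R%:E * v (first_pos k i).
  rewrite sumr_const card_class.
  by rewrite mule_natl.
by rewrite muleA -EFinM mulVf ?mul1e// pnatr_eq0.
Qed.

(** The classes are treated one after the other.  Rotating the class under
    treatment leaves unchanged every class mean, and the member at the first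
    position of any other class, so that the product of all the other factors
    can play the part of [F] in [joint_average]. *)
Lemma joint_prod_average (C : sample -> Theta -> R) :
  jointly_measurable C -> (forall w t, (0 <= C w t)%R) ->
  (forall i w t, C (tau i w) t = C w t) ->
  joint_mean (fun w t => C w t * \prod_(i < N) u (first_pos k i) w t)%R =
  joint_mean (fun w t => C w t * \prod_(i < N) class_mean i w t)%R.
Proof.
move=> mC C0 C_tau.
(* An interpolation between the two products, one factor per step. *)
pose x (n : nat) (i : 'I_N) w t :=
  if (i < n)%N then class_mean i w t else u (first_pos k i) w t.
pose G n w t := (C w t * \prod_(i < N) x n i w t)%R.
have mx n i : jointly_measurable (x n i).
  by rewrite /x; case: (i < n)%N; [exact: class_mean_meas|exact: u_meas].
have x0 n i w t : (0 <= x n i w t)%R.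
  by rewrite /x; case: ifP => _; [exact: class_mean_ge0|exact: u_ge0].
have step n : (n < N)%N -> joint_mean (G n) = joint_mean (G n.+1).
  move=> nN; pose i := Ordinal nN.
  pose F w t := (C w t * \prod_(j < N | j != i) x n j w t)%R.
  have GE : G n = fun w t => (F w t * u (first_pos k i) w t)%R.
    apply/funext => w; apply/funext => t; rewrite /G (bigD1 i)//= /F.
    by rewrite {1}/x /= ltnn mulrCA mulrC.
  have GSE : G n.+1 = fun w t => (F w t * class_mean i w t)%R.
    apply/funext => w; apply/funext => t; rewrite /G (bigD1 i)//= /F.
    rewrite {1}/x /= ltnSn mulrCA mulrC; congr (_ * _ * _)%R.
    apply: eq_bigr => j; rewrite /x ltnS [(j <= n)%N]leq_eqVlt -val_eqE /= => ji.
    by rewrite (negbTE ji).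
  rewrite GE GSE; apply: joint_average.
  - apply: measurable_funM => //; under eq_fun do rewrite -big_filter.
    by apply: measurable_prod => j _; exact: mx.
  - by move=> w t; rewrite mulr_ge0// prodr_ge0.
  - move=> w t; rewrite /F C_tau; congr (_ * _)%R; apply: eq_bigr => j ji.
    rewrite /x; case: ifP => _; first exact: class_mean_tau.
    rewrite u_tau rot_pos_neq// first_posK.
    by apply: contra ji => /eqP ji; apply/eqP/val_inj.
have GnE n : (n <= N)%N -> joint_mean (G 0%N) = joint_mean (G n).
  by elim: n => [|n IHn] nN; [reflexivity|exact: etrans (IHn (ltnW nN)) (step n nN)].
transitivity (joint_mean (G 0%N)); first by congr joint_mean.
rewrite (GnE N (leqnn N)); congr joint_mean; apply/funext => w; apply/funext => t.
by congr (_ * _)%R; apply: eq_bigr => i _; rewrite /x ltn_ord.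
Qed.

End averaging.
End JointExpectation.

(** * The penalty as a product of gains *)

Section Loss.
Context (R : realType) (dX dY dT : measure_display).
Context (X : measurableType dX) (Y : measurableType dY) (Theta : measurableType dT).
Hypothesis Y_finite : finite_set [set: Y].
Hypothesis Y_discrete : forall A : set Y, measurable A.

Lemma measurable_neq_finite d (S : measurableType d) (F G : S -> Y) :
  measurable_fun setT F -> measurable_fun setT G ->
  measurable_fun setT (fun s => (F s != G s)%:R : R).
Proof.
move=> mF mG.
have mA : measurable [set s | F s = G s].
  rewrite (_ : [set s | _] = \bigcup_(y in [set: Y])
      ((setT `&` F @^-1` [set y]) `&` (setT `&` G @^-1` [set y]))).
    apply: fin_bigcup_measurable => // y _.
    by apply: measurableI; [exact: mF|exact: mG].
  apply/seteqP; split => [s /= FG|s [y _ [[_ Fy] [_ Gy]]]].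
    by exists (F s).
  by rewrite /= Fy Gy.
rewrite (_ : (fun _ => _) = \1_(~` [set s | F s = G s])).
  by apply: measurable_indic; exact: measurableC.
apply/funext => s; rewrite indicE; congr (_%:R).
case: eqVneq => FG /=; first by rewrite memNset//= => /(_ FG).
by rewrite mem_set//=; apply/eqP.
Qed.

Variables (N k : nat) (f : Theta -> X -> Y).
Hypothesis N_gt0 : (0 < N)%N.
Hypothesis f_meas : measurable_fun [set: Theta * X] (fun z => f z.1 z.2).
Local Notation sample := ((k.+1 * N).-tuple (X * Y)).
Variable lambda : sample -> Theta -> R.
Hypothesis lambda_ge0 : forall w t, 0 <= lambda w t.
Hypothesis lambda_meas : measurable_fun [set: sample * Theta]
     (fun z => lambda z.1 z.2).
Hypothesis lambda_pexch : pexch_fun lambda.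
Implicit Types (w : sample) (t : Theta) (p q : 'I_(k.+1 * N)).

Lemma measurable_err p : measurable_fun [set: sample * Theta]
  (fun z => err R f z.2 (tnth z.1 p)).
Proof.
have mp : measurable_fun [set: sample * Theta] (fun z => tnth z.1 p).
  apply: (measurableT_comp (f := fun w : sample => tnth w p)) => //.
  exact: measurable_tnth.
apply: (@measurable_neq_finite _ _ (fun z => f z.2 (tnth z.1 p).1)
  (fun z => (tnth z.1 p).2)).
- apply: (measurableT_comp f_meas (g := fun z : sample * Theta => (z.2, (tnth z.1 p).1))).
  by apply: measurable_fun_pair => //; exact: measurableT_comp.
- exact: measurableT_comp.
Qed.

Definition shrink w t : R := 1 - expR (- (lambda w t / N%:R)).
Definition gain p w t : R := 1 - err R f t (tnth w p) * shrink w t.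
Definition mean_gain w t : R := 1 - rbar R f w t * shrink w t.
(** This is [mean_gain w t ^- N], written so that its measurability and its
    product with other exponentials are immediate. *)
Definition weight w t : R := expR (- (N%:R * ln (mean_gain w t))).

Lemma shrink_ge0 w t : 0 <= shrink w t.
Proof. by rewrite subr_ge0 -expR0 ler_expR oppr_le0 divr_ge0. Qed.

Lemma shrink_lt1 w t : shrink w t < 1.
Proof. by rewrite ltrBlDr ltrDl expR_gt0. Qed.

Lemma err_itv t (z : X * Y) : 0 <= err R f t z <= 1.
Proof. by rewrite /err; case: (_ != _); rewrite /= ?lexx ?ler01. Qed.

Lemma gain_ge0 p w t : 0 <= gain p w t.
Proof.
have /andP[e0 e1] := err_itv t (tnth w p).
have s1 := ltW (shrink_lt1 w t).
by rewrite subr_ge0 mulr_ile1// shrink_ge0.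
Qed.

(** An affine function and an exponential agree at the two values that an
    error indicator can take; the affine form is the one that can be averaged,
    the exponential one the one that multiplies up to the penalty. *)
Lemma gainE p w t :
  gain p w t = expR (- (lambda w t / N%:R) * err R f t (tnth w p)).
Proof.
rewrite /gain /shrink /err; case: (_ != _) => /=.
  by rewrite mul1r mulr1 opprB addrC subrK.
by rewrite mul0r subr0 mulr0 expR0.
Qed.

Lemma measurable_shrink :
  measurable_fun [set: sample * Theta] (fun z => shrink z.1 z.2).
Proof.
apply: measurable_funB => //; apply: measurableT_comp => //.
by apply: measurableT_comp => //; exact: measurable_funM.
Qed.

Lemma measurable_gain p :
  measurable_fun [set: sample * Theta] (fun z => gain p z.1 z.2).
Proof.
apply: measurable_funB => //; apply: measurable_funM.
  exact: measurable_err.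
exact: measurable_shrink.
Qed.

Lemma measurable_rbar :
  measurable_fun [set: sample * Theta] (fun z => rbar R f z.1 z.2).
Proof.
apply: measurable_funM => //.
by apply: measurable_sum => p; exact: measurable_err.
Qed.

Lemma measurable_weight :
  measurable_fun [set: sample * Theta] (fun z => weight z.1 z.2).
Proof.
apply: measurableT_comp => //; apply: measurableT_comp => //.
apply: measurable_funM => //; apply: measurableT_comp => //.
apply: measurable_funB => //; apply: measurable_funM.
  exact: measurable_rbar.
exact: measurable_shrink.
Qed.

Lemma shrink_tau (i : 'I_N) w t : shrink (tau i w) t = shrink w t.
Proof. by rewrite /shrink lambda_pexch. Qed.

Lemma rbar_tau (i : 'I_N) w t : rbar R f (tau i w) t = rbar R f w t.
Proof.
by rewrite /rbar; congr (_ * _); exact: sum_tau.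
Qed.

Lemma gain_tau (i : 'I_N) p w t : gain p (tau i w) t = gain (rot_pos i p) w t.
Proof. by rewrite /gain shrink_tau tnth_tau. Qed.

Lemma weight_tau (i : 'I_N) w t : weight (tau i w) t = weight w t.
Proof. by rewrite /weight /mean_gain shrink_tau rbar_tau. Qed.

Lemma rbar_le1 w t : rbar R f w t <= 1.
Proof.
rewrite /rbar ler_pdivrMl ?ltr0n ?muln_gt0//= mulr1.
rewrite (le_trans (ler_sum _ (fun p _ => (andP (err_itv t (tnth w p))).2)))//.
by rewrite sumr_const card_ord.
Qed.

Lemma mean_gain_gt0 w t : 0 < mean_gain w t.
Proof.
rewrite subr_gt0 (le_lt_trans _ (shrink_lt1 w t))//.
by rewrite ler_piMl ?rbar_le1 ?shrink_ge0.
Qed.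

(** [Phi] is made for this: [lambda * Phi (lambda / N) rbar] is
    [- N * ln (mean_gain)].  When [lambda] vanishes, so that [Phi] divides by
    0, both sides are 1. *)
Lemma expR_penalty_gain w t :
  expR (lambda w t * (Phi (lambda w t / N%:R) (rbar R f w t) - r1 R f w t)) =
  weight w t * \prod_(i < N) gain (first_pos k i) w t.
Proof.
under eq_bigr do rewrite gainE.
rewrite -expR_sum -expRD; congr expR.
rewrite -mulr_sumr /r1 (big_ord_narrow (leq_pmull N (ltn0Sn k))) /=.
have N0 : N%:R != 0 :> R by rewrite pnatr_eq0 -lt0n.
rewrite -/(first_pos k) mulrBr; congr (_ + _); last by rewrite mulrA mulNr.
have [l0|l0] := eqVneq (lambda w t) 0.
  by rewrite l0 /mean_gain /shrink l0 !mul0r oppr0 expR0 subrr mulr0 subr0 ln1 mulr0 oppr0.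
by rewrite /Phi /mean_gain /shrink; field; rewrite N0 l0.
Qed.

(** The classes have equal sizes, so the mean of the class means is the mean
    over all positions. *)
Lemma mean_gainE w t :
  mean_gain w t = (\sum_(i < N) class_mean gain i w t) / N%:R.
Proof.
have N0 : N%:R != 0 :> R by rewrite pnatr_eq0 -lt0n.
rewrite /class_mean -mulr_sumr.
have -> : \sum_(i < N) \sum_(q < k.+1 * N | (q %% N)%N == i) gain q w t =
    \sum_(q < k.+1 * N) gain q w t.
  pose c (q : 'I_(k.+1 * N)) : 'I_N := Ordinal (ltn_pmod q N_gt0).
  by rewrite [RHS](partition_big c predT).
rewrite /gain sumrB sumr_const card_ord -mulr_suml /mean_gain /rbar.
by rewrite natrM; field; rewrite N0 nat1r pnatr_eq0.
Qed.

(** The inequality of arithmetic and geometric means for the class means,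
    after multiplication by [mean_gain w t ^+ N]. *)
Lemma weight_class_mean_le1 w t :
  weight w t * \prod_(i < N) class_mean gain i w t <= 1.
Proof.
have D0 := mean_gain_gt0 w t.
rewrite /weight expRN expRM_natl lnK ?posrE// ler_pdivrMl ?exprn_gt0// mulr1.
have m0 : {in 'I_N, forall i : 'I_N, 0 <= class_mean gain i w t}.
  by move=> i _; apply: class_mean_ge0 => q v s; exact: gain_ge0.
by have := (leif_AGM m0).1; by rewrite card_ord -mean_gainE.
Qed.

End Loss.

(** * The deviation inequality *)

Lemma probability_integral_le1 d (S : measurableType d) (R : realType)
    (Q : probability S R) (g : S -> \bar R) :
  measurable_fun setT g -> (forall s, 0 <= g s)%E ->
  (forall s, g s <= 1)%E -> (\int[Q]_s g s <= 1)%E.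
Proof.
move=> mg g0 g1.
rewrite -[leRHS](@probability_setT _ _ _ Q) -[leRHS]mul1e -integral_cst//.
exact: ge0_le_integral.
Qed.

Theorem theorem2p2 (R : realType) (dX dY dT : measure_display)
  (X : measurableType dX) (Y : measurableType dY) (Theta : measurableType dT)
  (X_cg : countably_generated X) (Theta_cg : countably_generated Theta)
  (Y_finite : finite_set [set: Y])
  (Y_discrete : forall A : set Y, measurable A)
  (N k : nat) (N_gt0 : (0 < N)%N) (k_gt0 : (0 < k)%N)
  (f : Theta -> X -> Y)
  (f_meas : measurable_fun [set: Theta * X] (fun z => f z.1 z.2))
  (P : probability ((k.+1 * N).-tuple (X * Y)) R)
  (P_pexch : pexch_measure P)
  (lambda : (k.+1 * N).-tuple (X * Y) -> Theta -> R)
  (lambda_ge0 : forall w t, 0 <= lambda w t)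
  (lambda_meas : measurable_fun [set: (k.+1 * N).-tuple (X * Y) * Theta]
     (fun z => lambda z.1 z.2))
  (lambda_pexch : pexch_fun lambda)
  (pi : (k.+1 * N).-tuple (X * Y) -> pprobability Theta R)
  (pi_meas : measurable_fun [set: (k.+1 * N).-tuple (X * Y)] pi)
  (pi_pexch : pexch_posterior pi) :
  let Z (w : (k.+1 * N).-tuple (X * Y)) : \bar R :=
    expeR (sup_entropy
      (fun t => lambda w t *
         (Phi (lambda w t / N%:R) (rbar R f w t) - r1 R f w t))
      (pi w)) in
  measurable_fun [set: (k.+1 * N).-tuple (X * Y)] Z /\
  (\int[P]_w Z w <= 1)%E.
Proof.
move=> Z.
pose J w := (\int[pi w]_t (weight f lambda w t *
  \prod_(i < N) gain f lambda (first_pos k i) w t)%:E)%E.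
have mu := measurable_gain Y_finite Y_discrete f_meas lambda_meas.
have u0 := gain_ge0 f lambda_ge0.
have utau := gain_tau f lambda_pexch.
have mC := measurable_weight Y_finite Y_discrete f_meas lambda_meas.
have C0 w t : 0 <= weight f lambda w t by exact: expR_ge0.
have Ctau := weight_tau f lambda_pexch.
have mphi : measurable_fun [set: (k.+1 * N).-tuple (X * Y) * Theta]
    (fun z => weight f lambda z.1 z.2 *
      \prod_(i < N) gain f lambda (first_pos k i) z.1 z.2).
  by apply: measurable_funM => //; apply: measurable_prod => i _; exact: mu.
have mpen : measurable_fun [set: (k.+1 * N).-tuple (X * Y) * Theta] (fun z =>
    lambda z.1 z.2 *
      (Phi (lambda z.1 z.2 / N%:R) (rbar R f z.1 z.2) - r1 R f z.1 z.2)).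
  have -> : (fun z => lambda z.1 z.2 *
      (Phi (lambda z.1 z.2 / N%:R) (rbar R f z.1 z.2) - r1 R f z.1 z.2)) =
      fun z => ln (weight f lambda z.1 z.2 *
        \prod_(i < N) gain f lambda (first_pos k i) z.1 z.2).
    by apply/funext => z; rewrite -expR_penalty_gain// expRK.
  exact: measurableT_comp.
have ZE : Z = J.
  apply/funext => w; rewrite /Z donsker_varadhan.
    by apply: eq_integral => t _; rewrite expR_penalty_gain.
  exact: (measurableT_comp mpen (measurable_pair1 w)).
have G0 w t : 0 <= weight f lambda w t *
    \prod_(i < N) gain f lambda (first_pos k i) w t.
  by rewrite mulr_ge0// prodr_ge0.
rewrite ZE; split.
  exact: (measurable_posterior_mean pi_meas mphi G0).
rewrite [leLHS](joint_prod_average P_pexch pi_meas pi_pexch mu u0 utau mC C0 Ctau).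
have m0 i w t : 0 <= class_mean (gain f lambda) i w t by exact: class_mean_ge0.
have mm i := class_mean_meas mu i.
have mJ : measurable_fun [set: (k.+1 * N).-tuple (X * Y) * Theta]
    (fun z => weight f lambda z.1 z.2 *
      \prod_(i < N) class_mean (gain f lambda) i z.1 z.2).
  by apply: measurable_funM => //; apply: measurable_prod => i _; exact: mm.
have H0 w t : 0 <= weight f lambda w t *
    \prod_(i < N) class_mean (gain f lambda) i w t.
  by rewrite mulr_ge0// prodr_ge0.
apply: probability_integral_le1.
- exact: (measurable_posterior_mean pi_meas mJ H0).
- by move=> w; exact: (posterior_mean_ge0 pi w H0).
- move=> w; apply: (@probability_integral_le1 _ _ R (pi w)).
  + apply/measurable_EFinP.
    exact: (measurableT_comp mJ (measurable_pair1 w)).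
  + by move=> t; rewrite lee_fin.
  + by move=> t; rewrite lee_fin; exact: weight_class_mean_le1.
Qed.
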